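(* Let $X$ and $Y$ be connected CW complexes. For any map $f\colon Y\to X$, $$\mathrm{dcat}_1(f)\le\min\{\mathrm{dcat}(f),\ \mathrm{dcat}_1(Y),\ \mathrm{dcat}_1(X)\}.$$
   Context: All spaces are connected CW complexes and maps are continuous. For a space $Z$ and an integer $n\ge 1$, let $\mathcal B_n(Z)$ be the set of probability measures on $Z$ supported on at most $n$ points, i.e. formal sums $\sum_{i=1}^n a_i z_i$ with $z_i\in Z$, $a_i\ge 0$, $\sum a_i=1$ (a point $z$ standing for the Dirac measure $\delta_z$). It carries the topology of weak convergence of measures; for metric $Z$ this is the topology of the Lévy–Prokhorov metric. For a map $p\colon E\to B$ put $E_n=\{\mu\in\mathcal B_n(E)\mid \mathrm{supp}(\mu)\subset p^{-1}(b)\text{ for some } b\in B\}$, a subspace of $\mathcal B_n(E)$, and let $p_n\colon E_n\to B$ send $\mu$ to that $b$. If $p$ is a fibration, then so is $p_n$. For a map $f\colon Y\to X$: $\mathrm{dcat}_1(f)$ is the least integer $n\ge 0$ such that $f$ lifts along $q^X_{n+1}\colon\widetilde X_{n+1}\to X$, where $q^X\colon\widetilde X\to X$ is the universal covering; $\mathrm{dcat}(f)$ is the least integer $n\ge 0$ such that $f$ lifts along $e^X_{n+1}\colon P_0(X)_{n+1}\to X$, where $P_0(X)$ is the space of paths $\phi\colon[0,1]\to X$ with $\phi(1)=x_0$ ($x_0$ a fixed basepoint) and $e^X(\phi)=\phi(0)$. These are $\infty$ if no such $n$ exists. $\mathrm{dcat}_1(X)=\mathrm{dcat}_1(1_X)$.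 *)

(* Defs.v *)
From HB Require Import structures.
From mathcomp Require Import all_boot all_order all_algebra.
From mathcomp Require Import all_classical all_reals all_analysis.
From mathcomp Require Import homotopy.

Set Implicit Arguments.
Unset Strict Implicit.
Unset Printing Implicit Defensive.

Import Order.TTheory GRing.Theory Num.Theory.
Import numFieldNormedType.Exports.

Local Open Scope classical_set_scope.
Local Open Scope ring_scope.

Section CW.
Context (R : realType).

(* Euclidean discs: the norm that the library puts on row vectors is the sup
   norm (with the same topology), hence the explicit sum of squares. *)
Definition normsq n (v : 'rV[R]_n) : R := \sum_(i < n) v ord0 i ^+ 2.
Definition disc n : set 'rV[R]_n := [set v | normsq v <= 1].
Definition odisc n : set 'rV[R]_n := [set v | normsq v < 1].
Definition sphere n : set 'rV[R]_n := [set v | normsq v = 1].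

(* J. H. C. Whitehead's definition. Only the values of [Phi c] on the closed
   disc are meaningful; [cw_weak] is the weak topology (W) and [cw_boundary]
   contains closure-finiteness (C). *)
Record CW_structure (X : topologicalType) (C : Type) (dim : C -> nat)
    (Phi : forall c, 'rV[R]_(dim c) -> X) : Prop := {
  cw_continuous : forall c, {within @disc (dim c), continuous (Phi c)};
  cw_injective : forall c, {in @odisc (dim c) &, injective (Phi c)};
  cw_partition : forall x, exists! c, (Phi c @` @odisc (dim c)) x;
  cw_boundary : forall c, exists F : set C,
    [/\ finite_set F, (forall d, F d -> (dim d < dim c)%N) &
        Phi c @` @sphere (dim c) `<=` \bigcup_(d in F) Phi d @` @odisc (dim d)];
  cw_weak : forall A : set X,
    (forall c, closed (@disc (dim c) `&` Phi c @^-1` A)) -> closed A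
}.

Definition CW_complex (X : topologicalType) : Prop :=
  hausdorff_space X /\
  exists (C : Type) (dim : C -> nat) (Phi : forall c, 'rV[R]_(dim c) -> X),
    CW_structure Phi.

End CW.

Definition unit_interval (R : realType) : Type := set_type `[0 : R, 1].

HB.instance Definition _ (R : realType) :=
  Topological.copy (unit_interval R) (set_type `[0 : R, 1]).

Section UnitInterval.
Context (R : realType).

Lemma unit_interval0 : (0 : R) \in `[0 : R, 1]%classic.
Proof. by rewrite inE /= in_itv /= lexx ler01. Qed.

Lemma unit_interval1 : (1 : R) \in `[0 : R, 1]%classic.
Proof. by rewrite inE /= in_itv /= ler01 lexx. Qed.

Lemma unit_interval_neq :
  (exist _ 0 unit_interval0 : unit_interval R) != exist _ 1 unit_interval1.
Proof. by apply/eqP => /(congr1 sval) /eqP; rewrite /= eq_sym oner_eq0. Qed.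

HB.instance Definition _ :=
  isBiPointed.Build (unit_interval R) unit_interval_neq.

End UnitInterval.

Section SimplyConnected.
Context (R : realType).
Local Notation I := (unit_interval R).

Definition path_connected (Z : topologicalType) : Prop :=
  [set: Z] !=set0 /\ forall x y : Z, inhabited {path I from x to y}.

(* [H (t, s)] is the homotopy at time [s]; it is relative to the endpoints. *)
Definition null_homotopic (Z : topologicalType) (x : Z)
    (p : {path I from x to x}) : Prop :=
  exists H : I * I -> Z,
    [/\ continuous H,
        forall t, H (t, zero) = p t,
        forall t, H (t, one) = x,
        forall s, H (zero, s) = x &
        forall s, H (one, s) = x].

Definition simply_connected (Z : topologicalType) : Prop :=
  path_connected Z /\
  forall (x : Z) (p : {path I from x to x}), null_homotopic p.

End SimplyConnected.

Section Covering.
Context (E B : topologicalType).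

(* [q] restricts to a homeomorphism from [V] onto [U], with inverse [s]; the
   continuity of [q] itself is part of [covering]. *)
Definition sheet (q : E -> B) (V : set E) (U : set B) : Prop :=
  open V /\
  exists s : B -> E,
    [/\ {within U, continuous s},
        forall e, V e -> U (q e) /\ s (q e) = e &
        forall b, U b -> V (s b) /\ q (s b) = b].

Definition covering (q : E -> B) : Prop :=
  continuous q /\
  forall b, exists U : set B, open_nbhs b U /\
    exists (J : Type) (V : J -> set E),
      [/\ q @^-1` U = \bigcup_j V j, trivIset setT V &
          forall j, sheet q (V j) U].

Definition universal_covering (R : realType) (q : E -> B) : Prop :=
  covering q /\ simply_connected R E.

End Covering.

(* The library's measurable types carry a distinguished point, whence the
   [ptopologicalType] below; the point plays no role otherwise. *)
Definition borel (Z : ptopologicalType) := g_sigma_algebraType (@open Z).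

Section WeakConvergence.
Context (R : realType) (Z : ptopologicalType).

Definition bounded_continuous : Type :=
  {f : Z -> R | continuous f /\ bounded_fun f}.

Definition integrals (mu : probability (borel Z) R) :
    prod_topology (fun _ : bounded_continuous => R) :=
  fun f => \int[mu]_z (sval f z).

Definition borel_probability : Type := probability (borel Z) R.

HB.instance Definition _ := Choice.copy borel_probability
  (probability (borel Z) R).

(* Weak convergence: the coarsest topology for which all the maps
   [mu |-> \int[mu] f], [f] bounded and continuous, are continuous. *)
HB.instance Definition _ :=
  Topological.copy borel_probability (initial_topology integrals).

Definition measure_of (mu : borel_probability) : probability (borel Z) R := mu.

(* [A] ranges over all sets, not only the Borel ones: a measure of the library
   is a function on all sets, constrained on the measurable ones only, and this
   fixes the otherwise arbitrary values, so that a formal sum determines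
   exactly one element. *)
Definition formal_sums (n : nat) : set borel_probability :=
  [set mu | exists (a : 'I_n -> R) (z : 'I_n -> Z),
    [/\ forall i, 0 <= a i,
        \sum_(i < n) a i = 1 &
        forall A : set (borel Z),
          measure_of mu A =
          (\sum_(i < n) (a i)%:E * \d_(z i : borel Z) A)%E]].

(* For a formal sum, the points of nonzero weight. *)
Definition supp (mu : borel_probability) : set Z :=
  [set z | measure_of mu [set z : borel Z] <> 0%E].

End WeakConvergence.

Section Fibrewise.
Context (R : realType) (E : ptopologicalType) (B : topologicalType).

Definition fibrewise_set (p : E -> B) (n : nat) : set (borel_probability R E) :=
  [set mu | formal_sums n mu /\ exists b, supp mu `<=` p @^-1` [set b]].

Definition fibrewise (p : E -> B) (n : nat) : topologicalType :=
  set_type (fibrewise_set p n).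

(* [cid] chooses [b]; the support is not empty, so there is only one. *)
Definition fibrewise_proj (p : E -> B) (n : nat) (mu : fibrewise p n) : B :=
  projT1 (cid (set_mem (svalP mu)).2).

Definition lifts (p : E -> B) (n : nat) (Y : topologicalType) (f : Y -> B) :
    Prop :=
  exists g : Y -> fibrewise p n,
    continuous g /\ forall y, fibrewise_proj (g y) = f y.

End Fibrewise.

Section PathSpace.
Context (R : realType) (X : topologicalType) (x0 : X).
Local Notation I := (unit_interval R).

Definition based_paths : set {compact-open, I -> X} :=
  [set phi | continuous (phi : I -> X) /\ (phi : I -> X) one = x0].

Definition path_space : Type := set_type based_paths.

HB.instance Definition _ := Topological.copy path_space (set_type based_paths).

Lemma based_paths_cst : (cst x0 : {compact-open, I -> X}) \in based_paths.
Proof. by rewrite inE; split=> // t; exact: cst_continuous. Qed.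

HB.instance Definition _ :=
  isPointed.Build path_space (exist _ (cst x0) based_paths_cst).

Definition path_start (phi : path_space) : X := (set_val phi : I -> X) zero.

End PathSpace.

Definition least (R : realType) (P : nat -> Prop) : \bar R :=
  if pselect (exists n, `[< P n >]) is left exP then (ex_minn exP)%:R%:E
  else +oo%E.

(* [q] stands for the universal covering of the target of [f]. *)
Definition dcat1 (R : realType) (Xt : ptopologicalType) (X Y : topologicalType)
    (q : Xt -> X) (f : Y -> X) : \bar R :=
  least R (fun n => lifts R q n.+1 f).

Definition dcat (R : realType) (X : topologicalType) (x0 : X)
    (Y : topologicalType) (f : Y -> X) : \bar R :=
  least R (fun n => lifts R (@path_start R X x0) n.+1 f).

(* Main.v *)
Require Import Defs.
From mathcomp Require Import all_boot all_order all_algebra.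
From mathcomp Require Import all_classical all_reals all_analysis.
From mathcomp Require Import homotopy ring lra measurable_realfun.
Import Order.TTheory GRing.Theory Num.Theory.
Import numFieldNormedType.Exports.
Local Open Scope classical_set_scope.
Local Open Scope ring_scope.

Set Implicit Arguments.
Unset Strict Implicit.
Unset Printing Implicit Defensive.

(* A continuous map E -> E' over a continuous map B -> B' pushes measures
   forward, hence turns lifts to E_n into lifts to E'_n. The bound by dcat_1(X)
   is composition with f. The one by dcat(f) comes from a map P_0(X) -> X~ over
   X: the endpoint of the lift of the reversed path, continuous by homotopy
   lifting. The one by dcat_1(Y) comes from a lift Y~ -> X~ of f o q^Y, which
   exists as a function because Y~ is simply connected, and is continuous
   because it is so along the characteristic maps of the cells of Y, which
   determine the topology of Y. *)

(** * Paths and coverings *)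

(** Both [P] and its complement are open, since [P] is constant on the neighbourhood [N] of each
    point. *)
Lemma connected_ind (T : topologicalType) (P : T -> Prop) :
  connected [set: T] ->
  (forall x : T, exists2 N : set T, nbhs x N & forall y z, N y -> N z -> P y -> P z) ->
  forall x y, P x -> P y.
Proof.
move=> cT loc x y Px.
suff -> : P = setT by [].
apply: cT; first by exists x.
- exists P; last by rewrite setTI.
  rewrite openE => z Pz; have [N Nz NP] := loc z.
  apply: filterS (Nz) => w Nw; exact: NP (nbhs_singleton Nz) Nw Pz.
- exists P; last by rewrite setTI.
  rewrite -openC openE => z Pz; have [N Nz NP] := loc z.
  apply: filterS (Nz) => w Nw Pw; apply: Pz.
  exact: NP Nw (nbhs_singleton Nz) Pw.
Qed.

Lemma glue_continuous (R : realType) (T : topologicalType) (u v : R -> T) a :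
  continuous u -> continuous v -> u a = v a ->
  continuous (fun t => if t <= a then u t else v t).
Proof.
move=> cu cv uva t; case: (ltgtP t a) => [ta|at_|->] W; rewrite ?nbhs_simpl /=.
- rewrite (ltW ta) => /cu nW.
  have nl : nbhs t [set s | s < a] by apply: open_nbhs_nbhs; split=> //; exact: open_lt.
  by apply: filterS (filterI (nW : nbhs t _) nl) => s [Ws /ltW sa] /=; rewrite /= sa.
- rewrite leNgt at_ /= => /cv nW.
  have nl : nbhs t [set s | s > a] by apply: open_nbhs_nbhs; split=> //; exact: open_gt.
  by apply: filterS (filterI (nW : nbhs t _) nl) => s [Ws sa] /=; rewrite /= leNgt sa.
- rewrite lexx => /[dup] /cu nu; rewrite uva => /cv nv.
  by apply: filterS (filterI (nu : nbhs a _) (nv : nbhs a _)) => s [us vs] /=; case: ifP.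
Qed.

Lemma pair_continuous (T U V : topologicalType) (f : T -> U) (g : T -> V) t :
  {for t, continuous f} -> {for t, continuous g} ->
  {for t, continuous (fun t => (f t, g t))}.
Proof. by move=> cf cg; exact: (cvg_pair (F := nbhs t) cf cg). Qed.

Section Covering.
Context (E B : topologicalType) (q : E -> B).
Hypothesis covq : covering q.

(** Continuity of [s] is required at the points of [U] in the ambient topology; for open [U] this
    agrees with continuity within [U], and it composes directly. *)
Definition local_section (U : set B) (V : set E) (s : B -> E) : Prop :=
  [/\ open V, forall b, U b -> {for b, continuous s},
      forall e, V e -> U (q e) /\ s (q e) = e &
      forall b, U b -> V (s b) /\ q (s b) = b].

(** Separation inside a fibre comes from the sheets: [q] is injective on each of them, so distinct
    points of a fibre lie in different, hence disjoint, sheets. *)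
Lemma evenly_covered b : exists2 U, open_nbhs b U &
  (forall e, U (q e) -> exists V s, V e /\ local_section U V s) /\
  (forall e e', U (q e) -> q e = q e' -> e <> e' ->
    exists V V', [/\ nbhs e V, nbhs e' V' & forall x y, V x -> V' y -> x <> y]).
Proof.
have [_ /(_ b)[U [[oU Ub] [J [V [qV tV sV]]]]]] := covq.
have inV e : U (q e) -> exists j, V j e.
  by move=> Ue; have : (q @^-1` U) e by []; rewrite qV => -[j _ Vj]; exists j.
exists U => //; split=> [e /inV[j Vje]|e e' Ue qe ee'].
  have [oV [s [cs Vs sV']]] := sV j; exists (V j), s; split=> //; split=> //.
  by move=> c Uc; rewrite continuous_open_subspace // in cs; apply: cs; rewrite inE.
have [j Vje] := inV _ Ue; have Ue' : U (q e') by rewrite -qe.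
have [k Vke'] := inV _ Ue'; exists (V j), (V k).
have [oj [sj [_ js _]]] := sV j; have [ok _] := sV k.
split; [exact: open_nbhs_nbhs..|move=> x y Vx Vy xy; apply: ee'].
have jk : j = k by apply: tV => //; exists x; split=> //; rewrite xy.
by move: Vke'; rewrite -jk => /js[_ <-]; have [_ <-] := js _ Vje; rewrite qe.
Qed.

Lemma covering_continuous : continuous q.
Proof. by case: covq. Qed.

(** The agreement set is open because [q] is injective on sheets; its complement is open because
    distinct points of a fibre are separated. *)
Lemma lift_unique (T : topologicalType) (c c' : T -> E) t0 :
  connected [set: T] -> continuous c -> continuous c' ->
  (forall t, q (c t) = q (c' t)) -> c t0 = c' t0 -> forall t, c t = c' t.
Proof.
move=> cT cc cc' qcc' + t; pattern t0, t.
apply: (connected_ind (P := fun t => c t = c' t)) => // x.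
have [U [oU Ux] [sec sep]] := evenly_covered (q (c x)).
have [exx'|exx'] := pselect (c x = c' x).
  have [V [s [Vx [oV _ Vs _]]]] := sec _ Ux.
  exists (c @^-1` V `&` c' @^-1` V).
    apply: filterI; [apply: cc|apply: cc']; apply: open_nbhs_nbhs; split=> //.
    by rewrite -exx'.
  move=> y z _ [Vcz Vc'z] _.
  by have [_ <-] := Vs _ Vcz; have [_ <-] := Vs _ Vc'z; rewrite qcc'.
have [V [V' [nV nV' VV']]] := sep _ _ Ux (qcc' x) exx'.
exists (c @^-1` V `&` c' @^-1` V').
  by apply: filterI; [apply: cc|apply: cc'].
by move=> y z [Vy V'y] _ /(VV' _ _ Vy V'y).
Qed.

(** The image of [q] is open and closed: an evenly covered set that meets it has a section defined
    on all of it. *)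
Lemma covering_surjective (e0 : E) : connected [set: B] -> forall b, exists e, q e = b.
Proof.
move=> cB b; have : exists e, q e = q e0 by exists e0.
pattern (q e0), b; apply: (connected_ind (P := fun b => exists e, q e = b)) => //.
move=> x; have [U [oU Ux] [sec _]] := evenly_covered x.
exists U; first exact: open_nbhs_nbhs.
move=> y z Uy Uz [e qe]; have [|V [s [_ [_ _ _ sU]]]] := sec e; first by rewrite qe.
by exists (s z); have [] := sU z Uz.
Qed.

End Covering.

(** * Parametrising the unit interval by the real line *)

Section Clamp.
Context (R : realType).

Definition clamp (t : R) : R := Num.max 0 (Num.min 1 t).

Lemma clamp_itv t : 0 <= clamp t <= 1.
Proof. by rewrite /clamp le_max lexx ge_max ler01 ge_min lexx. Qed.

Lemma clamp_id t : 0 <= t <= 1 -> clamp t = t.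
Proof. by case/andP=> t0 t1; rewrite /clamp (min_idPr t1) (max_idPr t0). Qed.

Lemma clamp0 : clamp 0 = 0.
Proof. by rewrite clamp_id // lexx ler01. Qed.

Lemma clamp1 : clamp 1 = 1.
Proof. by rewrite clamp_id // lexx ler01. Qed.

Lemma clampK t : clamp (clamp t) = clamp t.
Proof. by rewrite clamp_id // clamp_itv. Qed.

Lemma clamp_continuous : continuous clamp.
Proof.
move=> t; apply: continuous_max; first exact: cvg_cst.
by apply: continuous_min; [exact: cvg_cst|exact: cvg_id].
Qed.

Lemma affine_continuous (a b : R) : continuous (fun t : R => a + t * b).
Proof.
move=> t; apply: cvgD; first exact: cvg_cst.
by apply: cvgM; [exact: cvg_id|exact: cvg_cst].
Qed.

Lemma clamp_segment_continuous (a d : R) (u : R -> R) :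
  continuous u -> continuous (fun t => a + clamp (u t) * d).
Proof.
move=> cu t; apply: cvgD; first exact: cvg_cst.
apply: cvgM; last exact: cvg_cst.
by apply: (continuous_comp (f := u)); [exact: cu|exact: clamp_continuous].
Qed.

Lemma clamp_mem t : clamp t \in `[0 : R, 1]%classic.
Proof. by rewrite inE /= in_itv /= clamp_itv. Qed.

Definition clampI (t : R) : unit_interval R := exist _ (clamp t) (clamp_mem t).

Lemma clampI_continuous : continuous clampI.
Proof.
by apply: (continuous_comp_initial (w := set_val)) => t; exact: clamp_continuous.
Qed.

Lemma clampI0 : clampI 0 = zero.
Proof. by apply: eq_sig_hprop => //=; exact: clamp0. Qed.

Lemma clampI1 : clampI 1 = one.
Proof. by apply: eq_sig_hprop => //=; exact: clamp1. Qed.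

Lemma clampI_clamp t : clampI (clamp t) = clampI t.
Proof. by apply: eq_sig_hprop => //=; exact: clampK. Qed.

Lemma clampI_val (x : unit_interval R) : clampI (sval x) = x.
Proof.
apply: eq_sig_hprop => //=; case: x => x /= /[!inE] /=.
by rewrite in_itv /=; exact: clamp_id.
Qed.

Lemma R_connected : connected [set: R].
Proof. by apply/connected_intervalP => x y _ _. Qed.

Lemma between_ball (a t t' : R) (r : R) s : 0 <= s <= 1 ->
  ball a r t -> ball a r t' -> ball a r (t + s * (t' - t)).
Proof.
move=> /andP[s0 s1]; rewrite /ball /= !ltr_distlC => /andP[h1 h2] /andP[h3 h4].
by apply/andP; split; case: (leP t t') => tt; nra.
Qed.

End Clamp.

(** * Path and homotopy lifting *)

Section Lifting.
Context (R : realType) (E B : topologicalType) (q : E -> B).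
Hypothesis covq : covering q.

(** Liftability up to time [T] propagates inside any ball that [g] maps into an evenly covered set,
    so connectedness of the line does the work of a subdivision. *)
Lemma path_lift (g : R -> B) e0 : continuous g -> q e0 = g 0 ->
  exists c : R -> E, [/\ continuous c, c 0 = e0 &
    forall t, 0 <= t <= 1 -> q (c t) = g t].
Proof.
move=> cg qe0.
pose P T := exists c : R -> E, [/\ continuous c, c 0 = e0 &
    forall t, 0 <= t <= T -> q (c t) = g t].
have Ple T T' : T' <= T -> P T -> P T'.
  move=> TT [c [cc c0 qc]]; exists c; split=> // t /andP[t0 tT].
  by apply: qc; rewrite t0 (le_trans tT).
have P0 : P 0.
  exists (cst e0); split=> //; first exact: cst_continuous.
  by move=> t t0; rewrite qe0 (@le_anti _ _ 0 t).
suff : P 1 by [].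
move: (P0); apply: (connected_ind (@R_connected R)) => x.
have [U [oU Ux] [sec _]] := evenly_covered covq (g x).
have /nbhs_ballP[r /= r0 rU] : nbhs x (g @^-1` U).
  by apply: cg; exact: open_nbhs_nbhs.
exists (ball x r); first exact: nbhsx_ballx.
move=> y z xy xz Py.
have [z0|z0] := ltP z 0; first by apply: Ple (ltW z0) _; apply: P0.
have [zy|yz] := leP z y; first exact: Ple zy Py.
(* The extension starts at the maximum of 0 and [y]; if [y] is negative, 0 lies between [y] and [z],
   hence in the ball. *)
have {xy Py yz} [y0 xy yz [c [cc c0 qc]]] :
    [/\ 0 <= Num.max 0 y, ball x r (Num.max 0 y), Num.max 0 y <= z & P (Num.max 0 y)].
  have [y0|y0] := leP 0 y; first by split=> //; exact: ltW.
  split=> //; have /andP[s0 s1] : 0 <= - y / (z - y) <= 1.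
    by rewrite divr_ge0 ?subr_ge0 ?oppr_ge0 ?(ltW y0) ?(ltW yz) //=
         ler_pdivrMr ?subr_gt0 // mul1r lerDr.
  have := @between_ball R x y z r (- y / (z - y)).
  by rewrite s0 s1 divfK ?subr_eq0 ?gt_eqF // subrr; exact.
set y' := Num.max 0 y in y0 xy yz c cc c0 qc.
have Uc : U (q (c y')) by rewrite qc ?y0 ?lexx //; exact: rU.
have [V [s [Vc [oV cs Vs sV]]]] := sec _ Uc.
(* [k] runs from [y'] to [z] and is constant before and after, so [g \o k] stays in [U] at all real
   times. *)
pose k t := y' + clamp ((t - y') / (z - y')) * (z - y').
have kb t : ball x r (k t) by apply: between_ball => //; exact: clamp_itv.
exists (fun t => if t <= y' then c t else s (g (k t))); split.
- apply: glue_continuous => //.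
    move=> t; apply: (@continuous_comp _ _ _ k (s \o g)).
      apply: clamp_segment_continuous => v.
      apply: cvgM; last exact: cvg_cst.
      by apply: cvgB; [exact: cvg_id|exact: cvg_cst].
    by apply: continuous_comp; [exact: cg|apply: cs; exact: rU].
  rewrite /k subrr mul0r clamp0 mul0r addr0 -qc ?y0 ?lexx //.
  by have [_ ->] := Vs _ Vc.
- by rewrite y0.
- move=> t /andP[t0 tz]; case: ifPn => [ty|]; first by rewrite qc ?t0.
  rewrite -ltNge => yt; rewrite (sV _ _).2; last exact: rU.
  have zy : 0 < z - y' by rewrite subr_gt0 (lt_le_trans yt).
  rewrite /k clamp_id; first by rewrite divfK ?gt_eqF // addrC subrK.
  by rewrite divr_ge0 ?subr_ge0 ?(ltW yt) ?(ltW zy) //= ler_pdivrMr // mul1r lerB.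
Qed.

(* [L] is obtained by lifting each path [h (z, _)] separately; for fixed [z0],
   continuity at [(z0, t)] is an open and closed condition on [t], because over
   an evenly covered set [L] coincides with [s \o h] for a single section
   [s]. *)
Lemma homotopy_lift (Z : topologicalType) (h : Z * R -> B) (l0 : Z -> E) :
  continuous h -> continuous l0 -> (forall z, q (l0 z) = h (z, 0)) ->
  exists L : Z * R -> E, [/\ continuous L, forall z, L (z, 0) = l0 z &
    forall z t, q (L (z, t)) = h (z, clamp t)].
Proof.
move=> ch cl0 ql0; pose g (p : Z * R) := h (p.1, clamp p.2).
have cg : continuous g.
  move=> p; apply: (@continuous_comp _ _ _ (fun p : Z * R => (p.1, clamp p.2)) h).
    apply: pair_continuous; first exact: cvg_fst.
    by apply: continuous_comp; [exact: cvg_snd|exact: clamp_continuous].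
  exact: ch.
have lift z : {c : R -> E | [/\ continuous c, c 0 = l0 z &
    forall t, q (c t) = g (z, t)]}.
  apply: cid; have cgz : continuous (fun t => g (z, t)).
    move=> t; apply: (@continuous_comp _ _ _ (fun t : R => (z, t)) g); last exact: cg.
    by apply: pair_continuous; [exact: cvg_cst|exact: cvg_id].
  have [|c [cc c0 qc]] := path_lift cgz (e0 := l0 z).
    by rewrite /g /= clamp0 ql0.
  (* The lift is controlled on the unit interval only; freezing it outside makes the equation hold
     at all times. *)
  exists (c \o (@clamp R)); split=> [t||t] /=; last 2 first.
  - by rewrite clamp0.
  - by rewrite qc ?clamp_itv // /g /= clampK.
  by apply: continuous_comp; [exact: clamp_continuous|exact: cc].
pose L (p : Z * R) := sval (lift p.1) p.2.
have cL z : continuous (fun t => L (z, t)) by case: (proj2_sig (lift z)).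
have L0 z : L (z, 0) = l0 z by case: (proj2_sig (lift z)).
have qL z t : q (L (z, t)) = g (z, t).
  by case: (proj2_sig (lift z)) => _ _; apply.
exists L; split=> //.
have step z0 T : exists2 r, 0 < r & forall t' t, ball T r t' -> ball T r t ->
    {for z0, continuous (fun z => L (z, t'))} -> {for (z0, t), continuous L}.
  have [U [oU Ux] [sec _]] := evenly_covered covq (g (z0, T)).
  have [[N J] /= [nN nJ] NJ] : nbhs (z0, T) (g @^-1` U).
    by apply: cg; exact: open_nbhs_nbhs.
  have /nbhs_ballP[r /= r0 rJ] := nJ.
  have gU z t : N z -> ball T r t -> U (g (z, t)).
    by move=> Nz /rJ Jt; exact: (NJ (z, t)).
  exists r => // t' t Tt' Tt cL'.
  have Uc : U (q (L (z0, t'))).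
    by rewrite qL; apply: gU => //; exact: nbhs_singleton.
  have [V [s [Vc [oV cs Vs sV]]]] := sec _ Uc.
  (* Continuity of the slice at [t'] keeps [L (z, t')] in the sheet [V] for [z] near [z0]. *)
  have nV : nbhs z0 (N `&` [set z | V (L (z, t'))]).
    by apply: filterI => //; apply: cL'; exact: open_nbhs_nbhs.
  (* Along the segment from [t'] to [u] both sides lift the same path, and they agree at [t']. *)
  have Lsg z u : N z -> V (L (z, t')) -> ball T r u -> L (z, u) = s (g (z, u)).
    move=> Nz Vz Tu; pose k v := t' + clamp v * (u - t').
    have kb v : ball T r (k v) by apply: between_ball => //; exact: clamp_itv.
    have ck : continuous k by apply: clamp_segment_continuous => v; exact: cvg_id.
    have -> : u = k 1 by rewrite /k clamp1 mul1r addrC subrK.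
    have := @lift_unique E B q covq R (fun v => L (z, k v))
      (fun v => s (g (z, k v))) 0 (@R_connected R).
    apply.
    - by move=> v; apply: (continuous_comp (ck v)); exact: cL.
    - move=> v; apply: (@continuous_comp _ _ _ (fun v => (z, k v)) (s \o g)).
        by apply: pair_continuous; [exact: cvg_cst|exact: ck].
      by apply: continuous_comp; [exact: cg|apply: cs; exact: gU].
    - by move=> v; rewrite qL (sV _ _).2 //; exact: gU.
    - rewrite /k clamp0 mul0r addr0 -qL.
      by have [_ ->] := Vs _ Vz.
  have : (s \o g) x @[x --> (z0, t)] --> L (z0, t).
    have -> : L (z0, t) = (s \o g) (z0, t) by rewrite Lsg //; exact: nbhs_singleton.
    apply: continuous_comp; first exact: cg.
    by apply: cs; apply: gU => //; exact: nbhs_singleton.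
  apply: cvg_trans; apply: near_eq_cvg.
  exists (N `&` [set z | V (L (z, t'))], ball T r).
    by split=> //=; apply: open_nbhs_nbhs; split=> //; exact: ball_open.
  by move=> [z u] /= [[Nz Vz] Tu]; rewrite Lsg.
have cz z0 t : {for z0, continuous (fun z => L (z, t))}.
  have : {for z0, continuous (fun z => L (z, 0))}.
    have -> : (fun z => L (z, 0)) = l0 by apply: funext.
    exact: cl0.
  apply: (connected_ind (P := fun t => {for z0, continuous (fun z => L (z, t))})
    (@R_connected R)) => T.
  have [r r0 rL] := step z0 T; exists (ball T r); first exact: nbhsx_ballx.
  move=> t1 t2 b1 b2 /(rL _ _ b1 b2) cL2.
  apply: (@continuous_comp _ _ _ (fun z => (z, t2)) L) => //.
  by apply: pair_continuous; [exact: cvg_id|exact: cvg_cst].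
move=> [z0 T]; have [r r0 rL] := step z0 T.
by apply: (rL T T) => //; exact: ballxx.
Qed.

End Lifting.

(** * Lifting to coverings *)

Section Monodromy.
Context (R : realType) (T E B : topologicalType) (q : E -> B) (phi : T -> B).
Hypotheses (covq : covering q) (cphi : continuous phi).

(* Two points of [T * E] are linked when a path of the pullback of [q] along
   [phi] joins them; the two times [r] and [s] are arbitrary, so that reversing
   the path amounts to exchanging them. *)
Definition linked (x x' : T * E) : Prop :=
  exists (c : R -> T) (b : R -> E) (r s : R),
    [/\ continuous c, continuous b, forall t, q (b t) = phi (c t),
        (c r, b r) = x & (c s, b s) = x'].

Lemma linked_sym x x' : linked x x' -> linked x' x.
Proof. by move=> [c [b [r [s [cc cb qb cr cs]]]]]; exists c, b, s, r. Qed.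

Lemma linked_trans y x z : linked x y -> linked y z -> linked x z.
Proof.
move=> [c [b [r [s [cc cb qb <- <-]]]]] [c' [b' [r' [s' [cc' cb' qb' e <-]]]]].
case: e => ec eb.
(* On [-1, 0] this runs along [k] from time [r] to time [s], on [0, 1] along [k'] from [r'] to
   [s']. *)
pose join (W : topologicalType) (k k' : R -> W) (t : R) :=
  if t <= 0 then k (s + t * (s - r)) else k' (r' + t * (s' - r')).
have cjoin (W : topologicalType) (k k' : R -> W) : continuous k ->
    continuous k' -> k' r' = k s -> continuous (join W k k').
  move=> ck ck' kk'; apply: (@glue_continuous R W (fun t => k (s + t * (s - r)))
    (fun t => k' (r' + t * (s' - r')))).
  - by move=> t; apply: (@continuous_comp _ _ _ (fun t : R => s + t * (s - r)) k);
      [exact: affine_continuous|exact: ck].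
  - by move=> t; apply: (@continuous_comp _ _ _ (fun t : R => r' + t * (s' - r')) k');
      [exact: affine_continuous|exact: ck'].
  - by rewrite !mul0r !addr0.
exists (join T c c'), (join E b b'), (-1), 1; rewrite /join; split.
- exact: cjoin.
- exact: cjoin.
- by move=> t; case: ifP.
- by rewrite lerN10 mulN1r opprB addrC subrK.
- by rewrite ler10 mul1r addrC subrK.
Qed.

Lemma linked_total (t0 : T) e0 : @path_connected R T -> q e0 = phi t0 ->
  forall y, exists e, linked (t0, e0) (y, e).
Proof.
move=> [_ pT] qe0 y; have [g] := pT t0 y.
pose c (t : R) := g (clampI t).
have cc : continuous c.
  move=> t; apply: continuous_comp; first exact: clampI_continuous.
  exact: cts_fun.
have [t||b [cb b0 qb]] := @path_lift R E B q covq (phi \o c) e0.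
- by apply: continuous_comp; [exact: cc|exact: cphi].
- by rewrite /= /c clampI0 path_zero.
exists (b 1), c, (b \o (@clamp R)), 0, 1; split=> //.
- by move=> t; apply: continuous_comp; [exact: clamp_continuous|exact: cb].
- by move=> t; rewrite /= qb ?clamp_itv // /c /= clampI_clamp.
- by rewrite /c /= clampI0 path_zero clamp0 b0.
- by rewrite /c /= clampI1 path_one clamp1.
Qed.

(** A contraction of the loop is lifted to a square starting at [e]. One side is [b], which ends at
    [e']; the sides over the constant point [y] are constant, so the corner opposite to the start is
    both [e] and [e']. *)
Lemma linked_inj y e e' : simply_connected R T ->
  linked (y, e) (y, e') -> e = e'.
Proof.
move=> [_ sT] [c [b [r [s [cc cb qb [cr br] [cs bs]]]]]].
pose g (t : unit_interval R) := c (r + sval t * (s - r)).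
have cg : continuous g.
  move=> t; apply: (@continuous_comp _ _ _
    (fun t : unit_interval R => r + sval t * (s - r)) c); last exact: cc.
  apply: (@continuous_comp _ _ _ (fun t : unit_interval R => sval t) (fun t => r + t * (s - r))).
    exact: (@initial_continuous (set_type `[0 : R, 1]) R set_val).
  exact: affine_continuous.
have g0 : g zero = y by rewrite /g /= mul0r addr0.
have g1 : g one = y by rewrite /g /= mul1r addrC subrK.
have [H [cH H0 H1 Hz Ho]] := sT y (mk_path cg g0 g1).
(* The coordinates are exchanged: lifting proceeds in path time, starting from the side at time 0,
   which lies over the single point [phi y]. *)
pose K (p : R * R) := phi (H (clampI p.2, clampI p.1)).
have cK : continuous K.
  move=> p; apply: (@continuous_comp _ _ _ (fun p : R * R => (clampI p.2, clampI p.1)) (phi \o H)).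
    apply: pair_continuous.
      by apply: continuous_comp; [exact: cvg_snd|exact: clampI_continuous].
    by apply: continuous_comp; [exact: cvg_fst|exact: clampI_continuous].
  by apply: continuous_comp; [exact: cH|exact: cphi].
have qe : q e = phi y by rewrite -br qb cr.
have qe' : q e' = phi y by rewrite -bs qb cs.
have [||L [cL L0 qL]] := @homotopy_lift R E B q covq R K (cst e) cK.
- exact: cst_continuous.
- by move=> z; rewrite /K /= clampI0 Hz.
have cL1 u : continuous (fun t => L (u, t)).
  move=> t; apply: (@continuous_comp _ _ _ (fun t : R => (u, t)) L); last exact: cL.
  by apply: pair_continuous; [exact: cvg_cst|exact: cvg_id].
have cL2 u : continuous (fun t => L (t, u)).
  move=> t; apply: (@continuous_comp _ _ _ (fun t : R => (t, u)) L); last exact: cL.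
  by apply: pair_continuous; [exact: cvg_id|exact: cvg_cst].
have uniq := @lift_unique E B q covq R _ _ 0 (@R_connected R).
have Lb t : L (0, t) = b (r + clamp t * (s - r)).
  apply: (uniq (fun t => L (0, t)) (fun t => b (r + clamp t * (s - r)))) => //.
  - move=> v; apply: (@continuous_comp _ _ _
      (fun t : R => r + clamp t * (s - r)) b); last exact: cb.
    by apply: clamp_segment_continuous => w; exact: cvg_id.
  - move=> v; rewrite qL /K /= clampI_clamp clampI0 H0 qb /=.
    by rewrite /mk_path /g /=.
  - by rewrite L0 clamp0 mul0r addr0 br.
have L1 t : L (t, 1) = e'.
  apply: (uniq (fun t => L (t, 1)) (cst e')) => //.
  - exact: cst_continuous.
  - by move=> v; rewrite qL /K /= clamp1 clampI1 Ho qe'.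
  - by rewrite Lb clamp1 mul1r addrC subrK bs.
rewrite -(L1 1); apply/esym; apply: (uniq (fun t => L (1, t)) (cst e)) => //.
- exact: cst_continuous.
- by move=> v; rewrite qL /K /= clampI1 H1 qe.
- by rewrite L0.
Qed.

(* The second conclusion says that [F] maps every path to a lift; [F] need not
   be continuous, for lack of local path-connectedness of [T]. *)
Lemma simply_connected_lift (t0 : T) (e0 : E) :
  simply_connected R T -> q e0 = phi t0 ->
  exists F : T -> E, (forall y, q (F y) = phi y) /\
    forall (c : R -> T) (b : R -> E), continuous c -> continuous b ->
      (forall t, q (b t) = phi (c t)) -> b 0 = F (c 0) -> b 1 = F (c 1).
Proof.
move=> sT qe0; have /choice[F FP] := linked_total sT.1 qe0.
exists F; split.
  by move=> y; have [c [b [r [s [_ _ qb _ [<- <-]]]]]] := FP y.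
(* Both points over [c 1] are linked to [(t0, e0)], one by the choice of [F], the other through
   [(c 0, F (c 0))]. *)
move=> c b cc cb qb b0; apply: (@linked_inj (c 1)) => //.
apply: linked_trans (FP (c 1)); apply: linked_sym.
apply: linked_trans (FP (c 0)) _.
by exists c, b, 0, 1; rewrite b0.
Qed.

End Monodromy.

Lemma within_continuousT_comp (T U V : topologicalType) (A : set U)
    (f : U -> V) (g : T -> U) :
  {within A, continuous f} -> continuous g -> (forall t, A (g t)) ->
  continuous (f \o g).
Proof.
move=> /subspace_sigL_continuousP cf cg Ag.
pose g' t : set_type A := exist _ (g t) (mem_set (Ag t)).
have cg' : continuous g' by exact: (continuous_comp_initial (w := set_val)).
have -> : f \o g = sigL A f \o g' by [].
by move=> t; apply: continuous_comp; [exact: cg'|exact: cf].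
Qed.

(** * Convexity of Euclidean discs *)

Section Disc.
Context (R : realType) (n : nat).
Implicit Types v w : 'rV[R]_n.

Lemma normsq_continuous : continuous (@normsq R n).
Proof.
apply: continuous_big => [|i _]; first exact: add_continuous.
move=> v; have ci := @coord_continuous R 1 n ord0 i v.
exact: (cvgM ci ci).
Qed.

Lemma disc_closed : closed (@disc R n).
Proof.
have -> : @disc R n = @normsq R n @^-1` [set x | x <= 1] by [].
apply: closed_comp; last exact: closed_le.
by move=> v _; exact: normsq_continuous.
Qed.

Lemma disc_convex v w (t : R) : 0 <= t <= 1 -> disc v -> disc w ->
  disc (v + t *: (w - v)).
Proof.
rewrite /disc /normsq /= => /andP[t0 t1] v1 w1.
apply: (@le_trans _ _ (\sum_(i < n)
    ((1 - t) * v ord0 i ^+ 2 + t * w ord0 i ^+ 2))).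
  apply: ler_sum => i _; rewrite !mxE.
  set a := v _ _; set b := w _ _.
  (* The gap in the convexity inequality for the square. *)
  rewrite -subr_ge0 (_ : _ - _ = t * (1 - t) * (a - b) ^+ 2); last by ring.
  by rewrite mulr_ge0 ?sqr_ge0 // mulr_ge0 // subr_ge0.
rewrite big_split /= -!mulr_sumr.
rewrite [leRHS](_ : 1 = (1 - t) * 1 + t * 1); last by ring.
by apply: lerD; apply: ler_wpM2l; rewrite // subr_ge0.
Qed.

Lemma segment_continuous v w : continuous (fun t : R => v + clamp t *: (w - v)).
Proof.
move=> t; apply: cvgD; first exact: cvg_cst.
by apply: cvgZ; [exact: clamp_continuous|exact: cvg_cst].
Qed.

Lemma segment_ball v w (r : R) t : 0 <= t <= 1 -> ball v r w ->
  ball v r (v + t *: (w - v)).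
Proof.
move=> /andP[t0 t1]; rewrite -ball_normE /ball_ /= opprD addNKr normrN normrZ.
rewrite ger0_norm // distrC; apply: le_lt_trans.
by rewrite -[leRHS]mul1r ler_wpM2r.
Qed.

End Disc.

(** * Continuity of lifts over a CW complex *)

Section CWLift.
Context (R : realType) (X Y E Z : topologicalType).
Context (q : E -> X) (p : Z -> Y) (f : Y -> X).
Hypotheses (cwY : CW_complex R Y) (covp : covering p) (covq : covering q).
Hypothesis cf : continuous f.

(* In the disc of a cell the segments from a point give paths, along which [F]
   coincides with a local section of [q]; the weak topology of [Y] does the
   rest. *)
Lemma cw_lift_continuous (F : Z -> E) :
  (forall y, q (F y) = f (p y)) ->
  (forall (c : R -> Z) (b : R -> E), continuous c -> continuous b ->
    (forall t, q (b t) = f (p (c t))) -> b 0 = F (c 0) -> b 1 = F (c 1)) ->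
  continuous F.
Proof.
move=> qF Fpath; have [_ [C [dim [Phi [cPhi _ _ _ weakY]]]]] := cwY.
apply/continuousP => W oW; rewrite openE => z /= WFz.
have [U [oU Uz] [secp _]] := evenly_covered covp (p z).
have [V [s [Vz [oV cs Vs sV]]]] := secp _ Uz.
(* The preimage of [W] under [F], seen in [Y] through the section [s]; openness downstairs
   suffices. *)
pose O := [set u | U u /\ W (F (s u))].
suff oO : open O.
  have : nbhs z (V `&` p @^-1` O).
    apply: filterI; first exact: open_nbhs_nbhs.
    apply: (covering_continuous covp); apply: open_nbhs_nbhs; split=> //.
    by split=> //; have [_ ->] := Vs _ Vz.
  by apply: filterS => y [Vy [_]]; have [_ ->] := Vs _ Vy.
rewrite -closedC; apply: weakY => k d dO.
have Dd : disc d.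
  by apply: disc_closed; move: dO; apply: closure_subset; exact: subIsetl.
(* For a contradiction, [d] is mapped into [O] although it is a limit of disc points mapped outside
   [O]. *)
split=> // -[Ud WFd].
have qd : q (F (s (Phi k d))) = f (Phi k d) by rewrite qF (sV _ Ud).2.
have [U' [oU' Ud'] [secq _]] := evenly_covered covq (q (F (s (Phi k d)))).
have [V' [s' [Vd' [oV' cs' Vs' sV']]]] := secq _ Ud'.
have sd' : s' (f (Phi k d)) = F (s (Phi k d)) by rewrite -qd; have [_ ->] := Vs' _ Vd'.
pose O' := [set u | [/\ U u, U' (f u) & W (s' (f u))]].
have nO' : nbhs (Phi k d) O'.
  have n1 : nbhs (Phi k d) U by exact: open_nbhs_nbhs.
  have n2 : nbhs (Phi k d) (f @^-1` U').
    by apply: cf; apply: open_nbhs_nbhs; rewrite -qd.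
  have n3 : nbhs (Phi k d) (f @^-1` (s' @^-1` W)).
    apply: cf; apply: cs'; first by rewrite -qd.
    by apply: open_nbhs_nbhs; rewrite sd'.
  by apply: filterS (filterI n1 (filterI n2 n3)) => u [? []].
have /subspace_continuousP/(_ _ Dd O' nO') := cPhi k.
rewrite /= /within /= nbhs_simpl /= => /nbhs_ballP[r /= r0 rO'].
(* Take such a point [d'] close to [d]. The segment to it is mapped into [O'], so the path property
   gives [F (s (Phi k d')) = s' (f (Phi k d'))], which lies in [W]. *)
have [|d' [[Dd' nO]] dd'] := dO (ball d r); first exact: nbhsx_ballx.
apply: nO; pose e (t : R) := d + clamp t *: (d' - d).
have ce : continuous e by exact: segment_continuous.
have De t : disc (e t) by apply: disc_convex => //; exact: clamp_itv.
have O'e t : O' (Phi k (e t)).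
  by apply: rO' => //; apply: segment_ball => //; exact: clamp_itv.
have cPe : continuous (Phi k \o e) by exact: within_continuousT_comp (cPhi k) ce De.
have e0 : e 0 = d by rewrite /e clamp0 scale0r addr0.
have e1 : e 1 = d' by rewrite /e clamp1 scale1r addrC subrK.
have [Ud1 Ud1' Wd1] := O'e 1; rewrite e1 in Ud1 Ud1' Wd1.
split=> //.
have := Fpath (s \o (Phi k \o e)) (s' \o (f \o (Phi k \o e))).
rewrite /= e0 e1 => <- //.
- move=> t; apply: continuous_comp; first exact: cPe.
  by apply: cs; have [] := O'e t.
- move=> t; apply: continuous_comp; last first.
    by apply: cs'; have [] := O'e t.
  by apply: continuous_comp; [exact: cPe|exact: cf].
- by move=> t; have [Ut Ut' _] := O'e t; rewrite (sV' _ Ut').2 (sV _ Ut).2.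
Qed.

End CWLift.

(** * Lifting the space of based paths *)

Section PathSpaceLift.
Context (R : realType) (X E : topologicalType) (q : E -> X).
Hypothesis covq : covering q.

Lemma unit_interval_compact : compact [set: unit_interval R].
Proof.
have -> : [set: unit_interval R] = @clampI R @` `[0 : R, 1]%classic.
  apply/seteqP; split=> // x _; exists (sval x); last exact: clampI_val.
  exact: set_mem (svalP x).
apply: continuous_compact; last exact: segment_compact.
by apply: continuous_subspaceT; exact: clampI_continuous.
Qed.

Lemma unit_interval_hausdorff : hausdorff_space (unit_interval R).
Proof.
move=> x y xy; rewrite -(clampI_val x) -(clampI_val y); congr clampI.
apply: (@Rhausdorff R) => A B nA nB.
have vc := @initial_continuous (set_type `[0 : R, 1]) R set_val.
have [z [Az Bz]] := xy _ _ (vc x _ nA) (vc y _ nB).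
by exists (sval z).
Qed.

(** The exponential law for the compact-open topology applies because the unit interval is compact
    Hausdorff, hence locally compact and regular. *)
Lemma path_eval_continuous (x0 : X) : continuous
  (fun p : path_space R x0 * R => (set_val p.1 : unit_interval R -> X) (clampI p.2)).
Proof.
have lc : locally_compact [set: unit_interval R].
  move=> x _; exists setT; first exact: filterT.
  by split; [exact: unit_interval_compact|exact: closedT].
have reg : regular_space (unit_interval R).
  move=> x; apply: (compact_regular (V := setT)) => //.
  - exact: unit_interval_hausdorff.
  - exact: unit_interval_compact.
  - exact: filterT.
have cv : continuous (set_val : path_space R x0 -> {compact-open, unit_interval R -> X}).
  exact: initial_continuous.
have cphi (phi : path_space R x0) : continuous (set_val phi : unit_interval R -> X).
  by have [] := set_mem (svalP phi).
have := continuous_uncurry_regular lc reg cv cphi.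
move=> cu z; apply: (@continuous_comp _ _ _
  (fun p : path_space R x0 * R => (p.1, clampI p.2))
  (uncurry (set_val : path_space R x0 -> unit_interval R -> X))).
  apply: pair_continuous; first exact: cvg_fst.
  by apply: continuous_comp; [exact: cvg_snd|exact: clampI_continuous].
exact: cu.
Qed.

(** With time reversed all paths start at [x0], so evaluation is a homotopy from a constant map; it
    is lifted from the constant [e0]. *)
Lemma path_space_lift (x0 : X) e0 : q e0 = x0 ->
  exists h : path_space R x0 -> E, continuous h /\
    forall phi, q (h phi) = path_start phi.
Proof.
move=> qe0.
pose h (p : path_space R x0 * R) := (set_val p.1 : unit_interval R -> X) (clampI (1 - p.2)).
have ch : continuous h.
  move=> z; apply: (@continuous_comp _ _ _
    (fun p : path_space R x0 * R => (p.1, 1 - p.2))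
    (fun p => (set_val p.1 : unit_interval R -> X) (clampI p.2)));
    last exact: path_eval_continuous.
  apply: pair_continuous; first exact: cvg_fst.
  by apply: cvgB; [exact: cvg_cst|exact: cvg_snd].
have [||L [cL _ qL]] := @homotopy_lift R E X q covq _ h (cst e0) ch.
- exact: cst_continuous.
- move=> phi; rewrite /h /= subr0 clampI1 qe0.
  by have [_ phi1] := set_mem (svalP phi); exact/esym/phi1.
exists (fun phi => L (phi, 1)); split=> [phi|phi].
  apply: (@continuous_comp _ _ _ (fun phi : path_space R x0 => (phi, 1 : R)) L); last exact: cL.
  by apply: pair_continuous; [exact: cvg_id|exact: cst_continuous].
by rewrite qL /h /= clamp1 subrr clampI0.
Qed.

End PathSpaceLift.


(** * Fibrewise measures *)

Section Pushforward.
Context (R : realType).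

Lemma borel_measurable (Z W : ptopologicalType) (h : Z -> W) :
  continuous h -> measurable_fun [set: borel Z] (h : borel Z -> borel W).
Proof.
move=> /continuousP ch.
apply: (measurability _ (erefl (@open W).-sigma.-measurable)) => _ [A oA <-].
by rewrite setTI; apply: sub_sigma_algebra; exact: ch.
Qed.

Lemma borel_measurableR (Z : ptopologicalType) (f : Z -> R) :
  continuous f -> measurable_fun [set: borel Z] (f : borel Z -> R).
Proof.
move=> /continuousP cf; apply: (measurability _ (RGenOpens.measurableE R)).
move=> _ [_ [a [b ->]] <-].
rewrite setTI; apply: sub_sigma_algebra; apply: cf.
exact: interval_open.
Qed.

Context (E E' : ptopologicalType) (h : E -> E').
Hypothesis ch : continuous h.

Definition borel_mfun : {mfun borel E >-> borel E'} :=
  MeasurableFun.Pack (MeasurableFun.Class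
    (isMeasurableFun.Build _ _ (borel E) (borel E') h (borel_measurable ch))).

Definition push (mu : borel_probability R E) : borel_probability R E' :=
  distribution (measure_of mu) borel_mfun.

(** By change of variables, integrating [g] against the image measure is integrating the bounded
    continuous function [g \o h] against [mu]. *)
Lemma push_continuous : continuous push.
Proof.
apply: (continuous_comp_initial (w := @integrals R E')) => mu.
apply/cvg_sup; first by apply: fmap_filter; exact: nbhs_filter.
move=> -[g [cg bg]].
have cgh : continuous (g \o h).
  by move=> x; apply: continuous_comp; [exact: ch|exact: cg].
have bgh : bounded_fun (g \o h).
  case: bg => M [Mr Mg]; exists M; split=> // N MN x _; exact: (Mg N MN (h x)).
pose gh : bounded_continuous R E := exist _ (g \o h) (conj cgh bgh).
have pushE nu : integrals (push nu) (exist _ g (conj cg bg)) = integrals nu gh.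
  rewrite /integrals /Rintegral /=; congr fine.
  rewrite integral_distribution //.
    by apply/measurable_EFinP; exact: borel_measurableR.
  apply: (@measurable_bounded_integrable _ (borel E) R (measure_of nu) (g \o h) setT) => //.
  - by rewrite (le_lt_trans (probability_le1 _ _)) ?ltry.
  - exact: borel_measurableR.
move=> U /= [_ [[W oW <-]] /= Wmu WU].
have FF : Filter (@integrals R E @ nbhs mu) by exact: fmap_filter.
have /cvg_sup/(_ gh) :=
  @initial_continuous (borel_probability R E) _ (@integrals R E) mu.
move=> /(_ ((fun k => k gh) @^-1` W)).
rewrite /= !nbhs_simpl /= => igW.
have : nbhs mu (@integrals R E @^-1` ((fun k => k gh) @^-1` W)).
  apply: igW; exists ((fun k => k gh) @^-1` W); split=> //=; last by rewrite -pushE.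
  by exists W.
by apply: filterS => nu Wnu; apply: WU; rewrite /= pushE.
Qed.
End Pushforward.

Section FormalSum.
Context (R : realType) (E : ptopologicalType).

(** Nonnegative weights cannot cancel, even when some of the points [z i] coincide. *)
Lemma supp_formal_sum n (mu : borel_probability R E) a (z : 'I_n -> E) :
  (forall i, 0 <= a i) ->
  (forall A : set (borel E),
     measure_of mu A = (\sum_(i < n) (a i)%:E * \d_(z i : borel E) A)%E) ->
  forall x, supp mu x <-> exists2 i, a i != 0 & z i = x.
Proof.
move=> a0 muE x; rewrite /supp /= muE; split.
  apply: contra_notP => nx; apply: big1 => i _.
  have [->|ai] := eqVneq (a i) 0; first by rewrite mul0e.
  rewrite diracE memNset ?mule0 // => zx; apply: nx.
  by exists i.
case=> i ai zi; apply/eqP; rewrite gt_eqF //.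
rewrite (bigD1 i) //= (@lt_le_trans _ _ (a i)%:E) //.
  by rewrite lte_fin lt_neqAle eq_sym ai a0.
rewrite zi diracE mem_set // mule1 leeDl // sume_ge0 // => j _.
by rewrite mule_ge0 // lee_fin.
Qed.

(** Weights of sum 1 are not all zero. A nonempty support makes the base point of a fibrewise
    measure unique. *)
Lemma formal_sums_supp n (mu : borel_probability R E) :
  formal_sums n mu -> supp mu !=set0.
Proof.
move=> [a [z [a0 a1 muE]]].
have [i ai] : exists i, a i != 0.
  apply: contrapT => /forallNP ai; have /eqP := oner_neq0 R; apply.
  by rewrite -a1 big1 // => i _; apply/eqP; apply: contrapT => /negP /ai.
by exists (z i); apply/(supp_formal_sum a0 muE); exists i.
Qed.

End FormalSum.

Section PushFormalSum.
Context (R : realType) (E E' : ptopologicalType).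
Context (h : E -> E') (ch : continuous h).

Lemma push_formal_sums n mu : formal_sums n mu ->
  formal_sums n (push ch mu : borel_probability R E') /\
  supp (push ch mu : borel_probability R E') `<=` h @` supp mu.
Proof.
move=> [a [z [a0 a1 muE]]].
(* Valid for every set [A] by computation: the Dirac mass at [z i] of the preimage of [A] is that at
   [h (z i)] of [A]. *)
have pE A : measure_of (push ch mu : borel_probability R E') A =
    (\sum_(i < n) (a i)%:E * \d_(h (z i) : borel E') A)%E.
  exact: muE.
split; first by exists a, (h \o z).
move=> x /(supp_formal_sum a0 pE)[i ai <-]; exists (z i) => //.
by apply/(supp_formal_sum a0 muE); exists i.
Qed.

End PushFormalSum.

Lemma fibrewise_projP (R : realType) (E : ptopologicalType)
    (B : topologicalType) (p : E -> B) n (mu : fibrewise R p n) b :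
  supp (set_val mu) `<=` p @^-1` [set b] -> fibrewise_proj mu = b.
Proof.
rewrite /fibrewise_proj; case: cid => b' /= mub' mub.
have [z zmu] := formal_sums_supp (set_mem (svalP mu)).1.
by rewrite -(mub _ zmu) -(mub' _ zmu).
Qed.

Section FibrewiseMap.
Context (R : realType) (E E' : ptopologicalType) (B B' : topologicalType).
Context (p : E -> B) (p' : E' -> B').

(** The map is the pushforward: [h] sends the fibre over [b] into the fibre over [f b]. *)
Lemma fibrewise_map n (h : E -> E') (f : B -> B') :
  continuous h -> (forall e, p' (h e) = f (p e)) ->
  exists G : fibrewise R p n -> fibrewise R p' n, continuous G /\
    forall mu, fibrewise_proj (G mu) = f (fibrewise_proj mu).
Proof.
move=> ch hf.
have supG (mu : fibrewise R p n) :
    supp (push ch (set_val mu)) `<=` p' @^-1` [set f (fibrewise_proj mu)].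
  have [fmu [b mub]] := set_mem (svalP mu).
  have [_ sp] := push_formal_sums ch fmu.
  move=> _ /sp[z zmu <-] /=; rewrite hf; congr f.
  by rewrite (fibrewise_projP mub); exact: mub.
have Gin (mu : fibrewise R p n) : push ch (set_val mu) \in @fibrewise_set R _ _ p' n.
  rewrite inE; split; last by exists (f (fibrewise_proj mu)); exact: supG.
  by have [] := push_formal_sums ch (set_mem (svalP mu)).1.
exists (fun mu => exist _ (push ch (set_val mu)) (Gin mu)); split.
- apply: (continuous_comp_initial (w := set_val)) => mu.
  apply: (continuous_comp (f := set_val) (g := @push R _ _ _ ch)).
    exact: initial_continuous.
  exact: push_continuous.
- by move=> mu; apply: fibrewise_projP; exact: supG.
Qed.

(** A lift is pushed forward along [h] and precomposed with [w]; all three inequalities are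
    instances. *)
Lemma lifts_map n (Y Y' : topologicalType) (h : E -> E') (f : B -> B')
    (u : Y -> B) (v : Y' -> B') (w : Y' -> Y) :
  continuous h -> (forall e, p' (h e) = f (p e)) ->
  continuous w -> (forall y, f (u (w y)) = v y) ->
  lifts R p n u -> lifts R p' n v.
Proof.
move=> ch hf cw fuw [g [cg gu]].
have [G [cG Gf]] := fibrewise_map n ch hf.
exists (G \o g \o w); split=> [y|y]; last by rewrite /= Gf gu fuw.
apply: continuous_comp; first exact: cw.
by apply: continuous_comp; [exact: cg|exact: cG].
Qed.

End FibrewiseMap.

(** * Comparison of the invariants *)

Lemma le_least (R : realType) (P Q : nat -> Prop) :
  (forall n, P n -> Q n) -> (least R Q <= least R P)%E.
Proof.
move=> PQ; rewrite /least; case: (pselect (exists n, `[< P n >])) => [exP|_]; last first.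
  by rewrite leey.
case: pselect => [exQ|[]]; last first.
  by case: exP => n /asboolP /PQ Qn; exists n; exact/asboolP.
rewrite lee_fin ler_nat; case: ex_minnP => m _; apply.
by case: ex_minnP => k /asboolP /PQ Qk _; exact/asboolP.
Qed.

Theorem proposition3p4 (R : realType) (X Y : topologicalType) (x0 : X)
    (cwX : CW_complex R X) (connX : connected [set: X])
    (cwY : CW_complex R Y) (connY : connected [set: Y])
    (Xt Yt : ptopologicalType) (qX : Xt -> X) (qY : Yt -> Y)
    (univX : universal_covering R qX) (univY : universal_covering R qY)
    (f : Y -> X) (contf : continuous f) :
  (dcat1 R qX f <=
   mine (dcat R x0 f) (mine (dcat1 R qY idfun) (dcat1 R qX idfun)))%E.
Proof.
have [covX _] := univX; have [covY scY] := univY.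
have surjX := covering_surjective covX (point : Xt) connX.
rewrite !le_min; apply/and3P; split; apply: le_least => n.
(* Bound by [dcat]: the map on total spaces goes from the path space to [Xt], over the identity of
   [X]. *)
- have [e0 qe0] := surjX x0.
  have [h [ch hq]] := path_space_lift R covX qe0.
  by apply: (lifts_map (f := idfun) (w := idfun) ch) => // y; exact: cvg_id.
(* Bound by [dcat1] of [Y]: the map on total spaces goes from [Yt] to [Xt], over [f]. *)
- pose phi y := f (qY y).
  have cphi : continuous phi.
    move=> y; apply: continuous_comp; last exact: contf.
    exact: covering_continuous.
  have [e0 qe0] := surjX (phi (point : Yt)).
  have [F [qF Fpath]] := simply_connected_lift covX cphi scY qe0.
  have cF : continuous F := cw_lift_continuous cwY covY covX contf qF Fpath.
  by apply: (lifts_map (f := f) (w := idfun) cF) => // y; exact: cvg_id.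
(* Bound by [dcat1] of [X]: the total space is unchanged, and a lift of the identity is precomposed
   with [f]. *)
- by apply: (lifts_map (h := idfun) (f := idfun) (w := f)) => // y; exact: cvg_id.
Qed.
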